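(* Let $r,n,d,m$ be positive integers. Then there exist $\gamma=\gamma(r,n,d,m)>0$ and $c=c(r,n,d,m)>0$ such that the following holds. If $\mathcal{H}$ is an $r$-uniform algebraic hypergraph of complexity $(n,d,m)$ on $N$ vertices, then $\mathcal{H}$ contains either a clique or an independent set of size at least $cN^{1/\gamma}$. Moreover, one can choose $$\gamma=2r^2m\left(\binom{n+d}{d}+1\right).$$
   Context: All hypergraphs are finite. For a set $V$, $V^{(s)}$ denotes the family of $s$-element subsets of $V$. An $r$-uniform hypergraph $\mathcal{H}$ is algebraic of complexity $(n,d,m)$ if there is a field $\mathbb{F}$ such that $V(\mathcal{H})$ is a (finite) subset of $\mathbb{F}^n$, and there exist $m$ polynomials $f_1,\dots,f_m:(\mathbb{F}^n)^r\to\mathbb{F}$ of degree at most $d$ and a Boolean formula (function) $\phi:\{\text{false},\text{true}\}^m\to\{\text{false},\text{true}\}$ such that $\{\mathbf{v}_1,\dots,\mathbf{v}_r\}\in V(\mathcal{H})^{(r)}$ is an edge if and only if $\phi([f_1(\mathbf{v}_1,\dots,\mathbf{v}_r)=0],\dots,[f_m(\mathbf{v}_1,\dots,\mathbf{v}_r)=0])=\text{true}$. It is assumed that for $\{\mathbf{v}_1,\dots,\mathbf{v}_r\}\in V(\mathcal{H})^{(r)}$ the left-hand side is invariant under permutations of $\mathbf{v}_1,\dots,\mathbf{v}_r$, so the edges are well defined. A clique is a set of vertices all of whose $r$-element subsets are edges; an independent set is a set of vertices none of whose $r$-element subsets is an edge. *)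

(* Defs.v *)
From HB Require Import structures.
From mathcomp Require Import all_boot all_order all_algebra.
From mathcomp Require Import finmap.
From mathcomp Require Import reals exp.
(* The notations of mpoly clash with those of the analysis library. *)
From mathcomp Require Import -(notations) mpoly.

Set Implicit Arguments.
Unset Strict Implicit.
Unset Printing Implicit Defensive.

Import Order.TTheory GRing.Theory Num.Theory.

Local Open Scope fset_scope.
Local Open Scope ring_scope.

Record hypergraph (r : nat) (T : choiceType) := Hypergraph {
  verts : {fset T};
  edges : {fset {fset T}};
  edgesP : forall e, e \in edges -> e `<=` verts /\ #|` e| = r
}.

Definition clique (r : nat) (T : choiceType) (H : hypergraph r T)
    (S : {fset T}) : Prop :=
  S `<=` verts H /\
  forall e : {fset T}, e `<=` S -> #|` e| = r -> e \in edges H.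

Definition independent (r : nat) (T : choiceType) (H : hypergraph r T)
    (S : {fset T}) : Prop :=
  S `<=` verts H /\
  forall e : {fset T}, e `<=` S -> #|` e| = r -> e \notin edges H.

(* A polynomial map (F^n)^r -> F is a polynomial in r * n variables, evaluated
   at the concatenation of the coordinates of v_1, ..., v_r. *)
Definition peval (F : fieldType) (r n : nat) (f : mpoly (r * n) F)
    (v : 'I_r -> 'rV[F]_n) : F :=
  meval (mxvec (\matrix_(i < r) v i) 0) f.

(* Total degree at most d: msize is the total degree plus one, and 0 for the
   zero polynomial. *)
Definition tdeg_le (F : fieldType) (k : nat) (f : mpoly k F)
    (d : nat) : Prop :=
  (mmeasure mdeg f <= d.+1)%N.

(* Since the equivalence is required for every ordering v of an r-subset of the
   vertices, the invariance of the condition under permutations of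
   v_1, ..., v_r is part of the definition. *)
Definition algebraic (F : fieldType) (n d m r : nat)
    (H : hypergraph r 'rV[F]_n) : Prop :=
  exists (f : 'I_m -> mpoly (r * n) F)
         (phi : {ffun 'I_m -> bool} -> bool),
    (forall j, tdeg_le (f j) d) /\
    forall v : 'I_r -> 'rV[F]_n,
      injective v -> (forall i, v i \in verts H) ->
      ([fset v i | i in 'I_r] \in edges H) =
      phi [ffun j => peval (f j) v == 0].

(* Main.v *)
Require Import Defs.
From HB Require Import structures.
From mathcomp Require Import all_boot all_order all_algebra.
From mathcomp Require Import finmap.
From mathcomp Require Import boolp.
From mathcomp Require Import reals exp.
From mathcomp Require Import -(notations) mpoly.

Set Implicit Arguments.
Unset Strict Implicit.
Unset Printing Implicit Defensive.

Import Order.TTheory GRing.Theory Num.Theory.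

Local Open Scope fset_scope.
Local Open Scope ring_scope.

(** Send a point x to the vector [monomials x] of its monomials of degree at
    most d, which has D = 'C(n + d, d) coordinates. When all but one of the
    arguments v_1, ..., v_r of a polynomial of degree at most d are fixed, the
    value is a linear form in the monomial vector of the remaining one
    ([low_degree_linear_in_each_slot]). The defining polynomials f_j enter the
    proof through this linearity.

    Let W be a set of vertices whose monomial vectors lie in a subspace U. Call
    a word q of at most r vertices null for f_j when f_j vanishes at every word
    of length r over W that ends with q. Suppose that q is not null. The x for
    which x :: q is null have their monomial vectors in a hyperplane that does
    not contain all those of W ([null_extension_hyperplane]), so keeping only
    these x lowers the dimension of U, which can happen at most D times.
    Therefore, at the cost of a constant power of the target size t per drop of
    dimension, every word that is not null may be assumed to have few null
    extensions. Then t vertices can be selected one by one, each avoiding all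
    null extensions of the words over the previous ones ([greedy_selection]).

    In the selected sequence, a subword of length at most r is null for f_j only
    if the empty word is, that is, only if f_j vanishes identically on W. A word
    of length r is null exactly when f_j is zero at it. Hence whether f_j
    vanishes on an r-subword of the selection depends on j alone
    ([zero_pattern_ramsey]), and the selection is a clique or an independent
    set, according to the value of the Boolean function at this zero pattern.

    The argument needs about t ^ ((r - 1) D + 1) vertices, and the exponent
    2 r^2 m (D + 1) leaves enough room to absorb the constant factors
    ([ramsey_threshold_bound]). *)

(** * Greedy selection *)

Fixpoint words (T : Type) (s : seq T) (k : nat) : seq (seq T) :=
  if k is k'.+1 then [::] :: [seq x :: w | x <- s, w <- words s k']
  else [:: [::]].

Lemma mem_words (T : eqType) (s q : seq T) (k : nat) :
  {subset q <= s} -> (size q <= k)%N -> q \in words s k.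
Proof.
elim: k q => [|k IHk] [|x q] //= sub le_qk.
rewrite in_cons /=; apply/allpairsP; exists (x, q); split=> //=.
  by apply: sub; rewrite mem_head.
by apply: IHk => // y yq; apply: sub; rewrite in_cons yq orbT.
Qed.

Lemma words_sub (T : eqType) (s q : seq T) (k : nat) :
  q \in words s k -> {subset q <= s} /\ (size q <= k)%N.
Proof.
elim: k q => [|k IHk] q /=; first by rewrite inE => /eqP->.
rewrite in_cons => /predU1P[-> //|/allpairsP[[x w] /= [xs /IHk[sub le] ->]]].
split=> // y; rewrite in_cons => /predU1P[-> //|]; exact: sub.
Qed.

Lemma size_words (T : Type) (s : seq T) (k : nat) :
  (0 < size (words s k) <= (size s).+1 ^ k)%N.
Proof.
elim: k => [|k /andP[lt0 le]] //=; rewrite size_allpairs expnS.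
apply: leq_trans (leq_mul (leqnn _) le); rewrite mulSn -addn1 addnC.
by rewrite leq_add2r.
Qed.

Lemma exists_avoiding (T : choiceType) (Bs : seq {fset T}) (W : {fset T}) :
  (\sum_(B <- Bs) #|` B| < #|` W|)%N ->
  exists2 x, x \in W & forall B, B \in Bs -> x \notin B.
Proof.
elim: Bs W => [|B Bs IH] W.
  by rewrite big_nil cardfs_gt0 => /fset0Pn[x xW]; exists x.
rewrite big_cons => lt.
have /IH[x] : (\sum_(C <- Bs) #|` C| < #|` W `\` B|)%N.
  rewrite cardfsD ltn_subRL; apply: leq_ltn_trans lt.
  by rewrite leq_add2r fsubset_leq_card // fsubsetIr.
rewrite inE => /andP[xB xW] avoid; exists x => // C.
by rewrite in_cons => /predU1P[->|/avoid].
Qed.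

(** Each new vertex has to avoid the previous ones, fewer than half of W, and
    the sets [bad q] for the at most [t.+1 ^ k] words q of length at most k over
    them, which together fill at most half of W. Vertices are added at the head
    of the sequence, so a subsequence x :: q was completed by the choice of
    x. *)
Lemma greedy_selection (T : choiceType) (W : {fset T})
    (bad : seq T -> {fset T}) (k t : nat) :
    (t.*2 <= #|` W|)%N ->
    (forall q, {subset q <= W} -> (size q <= k)%N ->
      ((t.+1 ^ k).*2 * #|` bad q| <= #|` W|)%N) ->
  exists s : seq T,
    [/\ uniq s, size s = t, {subset s <= W}
      & forall x q, subseq (x :: q) s -> (size q <= k)%N -> x \notin bad q].
Proof.
move=> tW badW.
have: (t <= t)%N by [].
elim: {-2}t => [_|i IHi lt_it]; first by exists [::]; split.
have [s [Us szs sW avoid]] := IHi (ltnW lt_it).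
have [|x xW xB] := @exists_avoiding _ ([fset x in s] :: map bad (words s k)) W.
  rewrite big_cons big_map card_fseq undup_id // szs.
  have sum_le : ((t.+1 ^ k).*2 * \sum_(q <- words s k) #|` bad q|
                  <= size (words s k) * #|` W|)%N.
    rewrite big_distrr /= -sum1_size big_distrl /= !big_seq.
    apply: leq_sum => q /words_sub[qs le_qk]; rewrite mul1n.
    by apply: badW => // y /qs /sW.
  have : ((t.+1 ^ k) * (\sum_(q <- words s k) #|` bad q|).*2
                  <= t.+1 ^ k * #|` W|)%N.
    rewrite -doubleMr doubleMl; apply: leq_trans sum_le _.
    rewrite leq_mul2r; apply/orP; right.
    have /andP[_ le] := size_words s k; apply: leq_trans le _.
    by rewrite szs; case: (posnP k) => [->|k0] //; rewrite leq_exp2r // ltnW.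
  rewrite leq_pmul2l ?expn_gt0 // => half.
  rewrite -ltn_double doubleD -[X in (_ < X)%N]addnn -addSn leq_add //.
  by apply: leq_trans tW; rewrite ltn_double.
have {}xs : x \notin s.
  by have := xB _ (mem_head _ _); rewrite inE.
exists (x :: s); split=> /=; first by rewrite xs.
- by rewrite szs.
- by move=> y; rewrite in_cons => /predU1P[->|/sW].
move=> y q; case: eqP => [-> sub le_qk|_ sub le_qk]; last exact: avoid.
apply: xB; rewrite in_cons map_f ?orbT //.
by apply: mem_words => //; apply: mem_subseq.
Qed.

(** * Ramsey theorem for the zero patterns of slotwise linear functions *)

Definition linear_in_each_slot (F : fieldType) (T : Type) (K r : nat)
    (phi : T -> 'rV[F]_K) (g : seq T -> F) : Prop :=
  forall p q : seq T, (size p + size q).+1 = r ->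
    exists c : 'cV[F]_K, forall x, g (p ++ x :: q) = (phi x *m c) 0 0.

(** The missing entries are put in front of q because selected vertices are
    added at the head of a sequence. At length r, being null just means being a
    zero of g; for the empty word, it means that g vanishes on W. *)
Definition null (F : fieldType) (T : choiceType) (r : nat) (g : seq T -> F)
    (W : {fset T}) (q : seq T) : Prop :=
  forall p : seq T, (size p + size q)%N = r -> {subset p <= W} ->
    g (p ++ q) = 0.

(** A completion p of q at which g is nonzero is nonempty, say it ends with y.
    Freeing the slot of y while keeping the rest of p and q gives a linear form
    that is nonzero at y, but that must vanish at every x making x :: q null. *)
Lemma null_extension_hyperplane (F : fieldType) (T : choiceType) (K r : nat)
    (phi : T -> 'rV[F]_K) (g : seq T -> F) (W : {fset T}) (q : seq T) :
    linear_in_each_slot r phi g -> (size q < r)%N -> ~ null r g W q ->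
  exists c : 'cV[F]_K,
    (exists2 y, y \in W & phi y *m c != 0) /\
    forall x, null r g W (x :: q) -> phi x *m c = 0.
Proof.
move=> lin lt_qr /existsNP[p /not_implyP[szp /not_implyP[pW gpq]]].
case/lastP: p => [|p y] in szp pW gpq *.
  by rewrite -szp add0n ltnn in lt_qr.
rewrite size_rcons addSn in szp; rewrite cat_rcons in gpq.
have [c gc] := lin p q szp; exists c; split.
  exists y; first by apply: pW; rewrite mem_rcons mem_head.
  by apply/eqP => yc0; apply: gpq; rewrite gc yc0 mxE.
move=> x nullx; apply/rowP => i; rewrite ord1 [RHS]mxE -gc; apply: nullx.
  by rewrite /= addnS.
by move=> z zp; apply: pW; rewrite mem_rcons in_cons zp orbT.
Qed.

Lemma rank_cap_kermx (F : fieldType) (K : nat) (U : 'M[F]_K) (y : 'rV[F]_K)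
    (c : 'cV[F]_K) :
  (y <= U)%MS -> y *m c != 0 -> (\rank (U :&: kermx c)%MS < \rank U)%N.
Proof.
move=> yU yc; apply: rank_ltmx; rewrite ltmxE capmxSl /=.
apply: contra yc => /(submx_trans yU) /submx_trans /(_ (capmxSr _ _)).
by move/sub_kermxP ->.
Qed.

Lemma not_null_subseq (F : fieldType) (T : choiceType) (r : nat)
    (g : seq T -> F) (W : {fset T}) (s : seq T) :
    (forall x q, subseq (x :: q) s -> (size q < r)%N -> ~ null r g W q ->
      ~ null r g W (x :: q)) ->
    ~ null r g W [::] ->
  forall q, subseq q s -> (size q <= r)%N -> ~ null r g W q.
Proof.
move=> step ?; elim=> [//|x q IHq] sub lt_qr; apply: step => //.
by apply: IHq; [apply: subseq_trans (subseq_cons q x) sub | apply: ltnW].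
Qed.

(** Induction on the dimension of U. Either some word that is not null has null
    extensions in a proportion more than 1 / A of W, and restricting to them
    lowers the dimension, or the greedy selection succeeds: here A is chosen so
    that the m functions and the words over at most t vertices forbid together
    at most half of W. *)
Lemma zero_pattern_ramsey (F : fieldType) (T : choiceType) (K m r t : nat)
    (phi : T -> 'rV[F]_K) (g : 'I_m -> seq T -> F) (U : 'M[F]_K)
    (W : {fset T}) :
    (0 < m)%N -> (0 < r)%N ->
    (forall j, linear_in_each_slot r phi (g j)) ->
    (forall x, x \in W -> (phi x <= U)%MS) ->
    (((t.+1 ^ r.-1).*2 * m) ^ \rank U * t.*2 <= #|` W|)%N ->
  exists (s : seq T) (Z : 'I_m -> bool),
    [/\ uniq s, size s = t, {subset s <= W}
      & forall q, subseq q s -> size q = r -> forall j, (g j q == 0) = Z j].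
Proof.
move=> m_gt0 r_gt0 lin; set A := (_.*2 * m)%N.
have A_gt0 : (0 < A)%N by rewrite muln_gt0 double_gt0 expn_gt0.
pose bad W j q :=
  [fset x in W | `[< ~ null r (g j) W q /\ null r (g j) W (x :: q) >]].
have [k] := ubnP (\rank U).
elim: k => // k IHk in U W * => rkU WU cardW.
have ltr q : (size q <= r.-1)%N = (size q < r)%N by rewrite -ltnS prednK.
have [[j [q [qW lt_qr big]]]|small] :=
  pselect (exists j q, [/\ {subset q <= W}, (size q < r)%N
                         & (#|` W| < A * #|` bad W j q|)%N]).
  have nnull : ~ null r (g j) W q.
    have /fset0Pn[x] : bad W j q != fset0.
      by apply: contraTneq big => ->; rewrite cardfs0 muln0.
    by rewrite !inE => /andP[_ /asboolP[]].
  have [c [[y yW yc] ker_c]] := null_extension_hyperplane (lin j) lt_qr nnull.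
  have rk_lt := rank_cap_kermx (WU y yW) yc.
  have badW : {subset bad W j q <= W} by move=> x; rewrite !inE => /andP[].
  have [|||] := IHk (U :&: kermx c)%MS (bad W j q).
  - by apply: leq_trans rk_lt _.
  - move=> x xbad; rewrite sub_capmx WU ?badW //=.
    apply/sub_kermxP; apply: ker_c; move: xbad.
    by rewrite !inE => /andP[_ /asboolP[]].
  - rewrite -(leq_pmul2l A_gt0) mulnA -expnS.
    apply: leq_trans (leq_trans cardW (ltnW big)).
    by rewrite leq_mul2r leq_pexp2l ?orbT.
  - move=> s [Z [Us szs sbad pattern]]; exists s, Z; split=> //.
    by move=> x /sbad /badW.
have tW : (t.*2 <= #|` W|)%N.
  by apply: leq_trans cardW; rewrite leq_pmull // expn_gt0 A_gt0.
have badW q : {subset q <= W} -> (size q <= r.-1)%N ->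
    ((t.+1 ^ r.-1).*2 * #|` \bigcup_(j <- enum 'I_m) bad W j q| <= #|` W|)%N.
  move=> qW; rewrite ltr => lt_qr; rewrite -(leq_pmul2l m_gt0) mulnCA mulnA -/A.
  apply: (@leq_trans (\sum_(j < m) A * #|` bad W j q|)).
    rewrite -big_distrr leq_mul2l /= -[X in (_ <= X)%N]big_enum.
    apply/orP; right.
    elim/big_ind2: _ => [|D1 n1 D2 n2 le1 le2|//]; first by rewrite cardfs0.
    by apply: leq_trans (leq_add le1 le2); rewrite leq_card_fsetU.
  rewrite -[X in (_ <= X * _)%N]card_ord -sum_nat_const; apply: leq_sum => j _.
  by rewrite leqNgt; apply/negP => big; apply: small; exists j, q.
have [s [Us szs sW avoid]] := greedy_selection tW badW.
exists s, (fun j => `[< null r (g j) W [::] >]); split=> // q qs szq j.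
apply/eqP/asboolP => [gq0|null0].
  apply: contrapT => nnull0.
  have nnull_q : ~ null r (g j) W q.
    apply: (not_null_subseq _ nnull0 qs); last by rewrite szq.
    move=> x p xps lt_pr nnull nullx.
    have := avoid x p xps; rewrite ltr => /(_ lt_pr)/negP; apply.
    apply/bigfcupP; exists j; rewrite ?mem_enum // !inE.
    by rewrite (sW x (mem_subseq xps (mem_head _ _))); apply/asboolP.
  by apply: nnull_q => p; rewrite szq -[RHS]add0n => /addIn/size0nil->.
by have := null0 q; rewrite cats0 addn0; apply => // x /(mem_subseq qs)/sW.
Qed.

(** * Polynomials of low degree are linear in each slot *)

Lemma big_mxvec_index (R : Type) (idx : R) (op : Monoid.com_law idx)
    (r n : nat) (G : 'I_(r * n) -> R) :
  \big[op/idx]_k G k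
  = \big[op/idx]_(a < r) \big[op/idx]_(b < n) G (mxvec_index a b).
Proof.
rewrite (reindex _ (curry_mxvec_bij r n)) pair_bigA /=.
by apply: eq_bigr => -[a b] _.
Qed.

(** Written with entries below [d.+1], a bound implied by the bound on the sum,
    to match [card_partial_ord_partitions]: there are 'C(n + d, n) of them. *)
Definition exponents (n d : nat) : {set n.-tuple 'I_d.+1} :=
  [set t : n.-tuple 'I_d.+1 | (\sum_(i <- t) i <= d)%N].

Definition monomials (F : fieldType) (n d : nat) (x : 'rV[F]_n) :
    'rV[F]_#|exponents n d| :=
  \row_(k < #|exponents n d|) \prod_(b < n) x 0 b ^+ tnth (enum_val k) b.

(** A monomial of f splits into one monomial for each slot, each of degree at
    most d. So with the other slots fixed it is a multiple of one coordinate of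
    [monomials]. *)
Lemma low_degree_linear_in_each_slot (F : fieldType) (r n d : nat)
    (f : mpoly (r * n) F) :
  tdeg_le f d ->
  linear_in_each_slot r (@monomials F n d)
    (fun q => peval f (fun i : 'I_r => nth 0 q i)).
Proof.
move=> deg_f p q szpq.
have lt_pr : (size p < r)%N by rewrite -szpq ltnS leq_addr.
pose i0 := Ordinal lt_pr.
suff [c cP] : exists c : 'cV[F]_#|exponents n d|, forall x,
    \sum_(e <- msupp f) mcoeff e f *
      \prod_k (mxvec (\matrix_(i < r) nth 0 (p ++ x :: q) i) 0 k) ^+ e k
    = (monomials d x *m c) 0 0.
  by exists c => x; rewrite /peval mevalE.
have: {in msupp f, forall e, (mdeg e <= d)%N}.
  by move=> e /msize_mdeg_lt lt_e; rewrite -ltnS (leq_trans lt_e).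
elim: (msupp f : seq _) => [|e E IHE] degE.
  by exists 0 => x; rewrite big_nil mulmx0 mxE.
have [|c cP] := IHE.
  by move=> e' e'E; apply: degE; rewrite in_cons e'E orbT.
have le_sum : (\sum_(b < n) e (mxvec_index i0 b) <= d)%N.
  apply: leq_trans (degE e (mem_head _ _)).
  by rewrite mdegE big_mxvec_index (bigD1 i0) //= leq_addr.
have le_e b : (e (mxvec_index i0 b) <= d)%N.
  by apply: leq_trans le_sum; rewrite (bigD1 b) //= leq_addr.
(* u is the exponent of the part of the monomial e that belongs to slot i0. *)
pose u : n.-tuple 'I_d.+1 := [tuple inord (e (mxvec_index i0 b)) | b < n].
have uE b : tnth u b = e (mxvec_index i0 b) :> nat.
  by rewrite tnth_mktuple inordK // ltnS.
have uM : u \in exponents n d.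
  by rewrite inE big_tuple (eq_bigr _ (fun b _ => uE b)).
(* a collects the other slots, so the 0 standing in for slot i0 is not read. *)
pose a := mcoeff e f * \prod_(i < r | i != i0) \prod_(b < n)
  nth 0 (p ++ 0 :: q) i 0 b ^+ e (mxvec_index i b).
exists (c + a *: delta_mx (enum_rank_in uM u) 0) => x.
rewrite big_cons cP mulmxDr [RHS]mxE addrC; congr (_ + _).
rewrite -scalemxAr mxE -colE !mxE enum_rankK_in // big_mxvec_index.
rewrite (bigD1 i0) //= /a -mulrA; congr (_ * _); rewrite mulrC; congr (_ * _).
  apply: eq_bigr => i ne_i; apply: eq_bigr => b _; rewrite mxvecE mxE !nth_cat.
  case: ltnP => // le_pi; case E' : (i - size p)%N => [|k] //.
  move: ne_i; rewrite -val_eqE /= eqn_leq le_pi andbT -subn_eq0 E'.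
  by [].
by apply: eq_bigr => b _; rewrite mxvecE mxE nth_cat ltnn subnn uE.
Qed.

(** * Homogeneous sets in algebraic hypergraphs *)

(** An r-subset of the selected vertices, listed as they occur in s, is a
    subsequence of length r, so all r-subsets have the same zero pattern. *)
Lemma algebraic_homogeneous_set (F : fieldType) (r n d m t : nat)
    (H : hypergraph r 'rV[F]_n) :
    (0 < r)%N -> (0 < m)%N -> algebraic d m H ->
    (((t.+1 ^ r.-1).*2 * m) ^ 'C(n + d, d) * t.*2 <= #|` verts H|)%N ->
  exists S : {fset 'rV[F]_n},
    (clique H S \/ independent H S) /\ #|` S| = t.
Proof.
move=> r_gt0 m_gt0 [f [b [deg_f edgesE]]] cardV.
pose g j (q : seq 'rV[F]_n) := peval (f j) (fun i : 'I_r => nth 0 q i).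
have lin j : linear_in_each_slot r (@monomials F n d) (g j).
  exact: low_degree_linear_in_each_slot.
have [||s [Z [Us szs sV pattern]]] :=
    @zero_pattern_ramsey _ _ _ m r t _ g 1%:M (verts H) m_gt0 r_gt0 lin.
- by move=> x _; apply: submx1.
- have -> : \rank (1%:M : 'M[F]_#|exponents n d|) = 'C(n + d, d).
    by rewrite mxrank1 card_partial_ord_partitions -bin_sub ?leq_addr // addKn.
  exact: cardV.
exists [fset x in s]; split; last by rewrite card_fseq undup_id.
have edge_s (e : {fset 'rV[F]_n}) : e `<=` [fset x in s] -> #|` e| = r ->
    (e \in edges H) = b [ffun j => Z j].
  move=> /fsubsetP es card_e; pose q := [seq x <- s | x \in e].
  have qE : q =i e.
    move=> x; rewrite mem_filter andb_idr // => /es; by rewrite inE.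
  have Uq : uniq q by rewrite filter_uniq.
  have szq : size q = r.
    by rewrite -card_e; apply/perm_size/uniq_perm.
  pose v (i : 'I_r) := nth 0 q i.
  have v_in i : v i \in e by rewrite -qE mem_nth // szq.
  have -> : e = [fset v i | i in 'I_r].
    apply/fsetP => x; apply/idP/imfsetP => [|[i _ -> //]].
    rewrite -qE => xq; have lt_i : (index x q < r)%N by rewrite -szq index_mem.
    by exists (Ordinal lt_i) => //=; rewrite /v nth_index.
  rewrite edgesE => [||i].
  - congr b; apply/ffunP => j; rewrite !ffunE.
    by rewrite -(pattern q _ szq) ?filter_subseq.
  - move=> i i' /eqP; rewrite nth_uniq ?szq // => /eqP; exact: val_inj.
  - by apply: sV; have := es _ (v_in i); rewrite inE.
have sub : [fset x in s] `<=` verts H.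
  by apply/fsubsetP => x; rewrite inE => /sV.
by case E: (b [ffun j => Z j]); [left | right]; split=> // e es card_e;
  rewrite edge_s // E.
Qed.

Lemma singleton_homogeneous (r : nat) (T : choiceType) (H : hypergraph r T)
    (x : T) :
  (0 < r)%N -> x \in verts H -> clique H [fset x] \/ independent H [fset x].
Proof.
move=> r_gt0 xV; have sub : [fset x] `<=` verts H by rewrite fsub1set.
have only e : e `<=` [fset x] -> #|` e| = r -> e = [fset x].
  rewrite fsubset1 => /orP[/eqP//|/eqP->]; rewrite cardfs0 => E.
  by rewrite -E in r_gt0.
by case E: ([fset x] \in edges H); [left|right]; split=> // e /only eE /eE ->;
  rewrite E.
Qed.

Lemma ramsey_threshold_bound (r m D t : nat) :
    (0 < r)%N -> (0 < m)%N -> (0 < t)%N ->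
  (((t.+1 ^ r.-1).*2 * m) ^ D * t.*2 <= (4 * m * t) ^ (2 * r ^ 2 * m * D.+1))%N.
Proof.
move=> r_gt0 m_gt0 t_gt0; set X := (4 * m * t)%N.
have X_gt0 : (0 < X)%N by rewrite !muln_gt0 m_gt0.
have tX : (t.*2 <= X)%N.
  by rewrite /X -mul2n leq_pmul2r // -[2%N]/(2 * 1)%N leq_mul.
have AX : ((t.+1 ^ r.-1).*2 * m <= X ^ r)%N.
  rewrite -[in (X ^ r)%N](prednK r_gt0) expnS -mul2n mulnAC.
  apply: leq_mul.
    by apply: leq_trans (leq_pmulr _ t_gt0); rewrite leq_mul2r orbT.
  case: (posnP r.-1) => [->|p0] //; rewrite leq_exp2r //.
  by apply: leq_trans tX; rewrite -addnn -addn1 leq_add2l.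
apply: (@leq_trans (X ^ (r * D) * X ^ 1)%N).
  by rewrite expnM expn1 leq_mul //; case: D => // D; rewrite leq_exp2r.
rewrite -expnD leq_pexp2l // addn1.
apply: (@leq_trans (r * D.+1)%N).
  by rewrite mulnS addnC -addn1 leq_add2l.
rewrite leq_mul2r /=; apply: leq_trans (leq_pmulr _ m_gt0).
by rewrite -mulnn mulnA leq_pmull // muln_gt0 r_gt0.
Qed.

Theorem theorem1p3 (R : realType) (r n d m : nat)
    (r_gt0 : (0 < r)%N) (n_gt0 : (0 < n)%N) (d_gt0 : (0 < d)%N)
    (m_gt0 : (0 < m)%N) :
  exists gamma c : R,
    [/\ 0 < gamma, 0 < c,
        gamma = 2 * r%:R ^+ 2 * m%:R * ('C(n + d, d)%:R + 1)
      & forall (F : fieldType) (H : hypergraph r 'rV[F]_n),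
          algebraic d m H ->
          exists S : {fset 'rV[F]_n},
            (clique H S \/ independent H S) /\
            c * #|` verts H|%:R `^ gamma^-1 <= #|` S|%:R].
Proof.
pose G := (2 * r ^ 2 * m * ('C(n + d, d)).+1)%N.
have G_gt0 : (0 < G)%N by rewrite !muln_gt0 r_gt0 m_gt0.
(* With t chosen below, N < (4 m (t + 1)) ^ G, and t + 1 is at most twice the
   size of the set found. *)
exists G%:R, (8 * m)%:R^-1; split.
- by rewrite ltr0n.
- by rewrite invr_gt0 ltr0n muln_gt0.
- by rewrite /G !natrM expr2 natr1.
move=> F H algH; set N := #|` verts H|.
suff [S [homS NS]] : exists S : {fset 'rV[F]_n},
    (clique H S \/ independent H S) /\ (N <= (8 * m * #|` S|) ^ G)%N.
  exists S; split=> //; rewrite mulrC ler_pdivrMr ?ltr0n ?muln_gt0 //.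
  rewrite mulrC -natrM.
  have -> : (8 * m * #|` S|)%:R = ((8 * m * #|` S|)%:R ^+ G) `^ G%:R^-1 :> R.
    by rewrite -powR_mulrn // -powRrM mulfV ?powRr1 // pnatr_eq0 -lt0n.
  by rewrite ge0_ler_powR ?invr_ge0 ?nnegrE ?exprn_ge0 // -natrX ler_nat.
have [N0|N_gt0] := posnP N.
  exists fset0; split; last by rewrite N0.
  left; split; first exact: fsub0set.
  move=> e; rewrite fsubset0 => /eqP-> card0.
  by rewrite -card0 cardfs0 in r_gt0.
pose P t := ((4 * m * t) ^ G <= N)%N.
have P0 : exists t, P t by exists 0%N; rewrite /P muln0 exp0n.
have Pmax t : P t -> (t <= N)%N.
  apply: leq_trans; apply: leq_trans (_ : t ^ 1 <= _)%N; first by rewrite expn1.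
  case: t => [|t]; first by rewrite exp0n.
  apply: leq_trans (_ : t.+1 ^ G <= _)%N; first by rewrite leq_pexp2l.
  by rewrite leq_exp2r // leq_pmull // muln_gt0.
(* The largest t for which the Ramsey bound applies; it may be 0, and then N is
   below a constant and a single vertex suffices. *)
have [t Pt maxt] := ex_maxnP P0 Pmax.
have ltN : (N < (4 * m * t.+1) ^ G)%N.
  by rewrite ltnNge; apply/negP => /maxt; rewrite ltnn.
have [S [homS le_tS]] : exists S : {fset 'rV[F]_n},
    (clique H S \/ independent H S) /\ (maxn t 1 <= #|` S|)%N.
  have [t0|t_gt0] := posnP t.
    have /fset0Pn[x xV] : verts H != fset0 by rewrite -cardfs_gt0.
    exists [fset x]; split; first exact: singleton_homogeneous.
    by rewrite t0 cardfs1.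
  have [|S [homS cardS]] :=
    @algebraic_homogeneous_set F r n d m t H r_gt0 m_gt0 algH.
    exact: leq_trans (ramsey_threshold_bound _ _ _ _) Pt.
  by exists S; split=> //; rewrite cardS geq_max leqnn.
exists S; split=> //; apply: leq_trans (ltnW ltN) _.
rewrite leq_exp2r // -[8%N]/(4 * 2)%N -!mulnA leq_mul2l /= mulnCA leq_mul2l.
move: le_tS; rewrite geq_max => /andP[tS S_gt0]; apply/orP; right.
by rewrite mul2n -addnn -addn1 leq_add.
Qed.
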